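(* Let $\mathcal{M}$ be a binary matroid represented by $v_1,\ldots,v_k\in\{0,1\}^k$. If $\mathcal{M}$ has complexity $1$, then there exist a function $\tau:\mathbb{R}^+\to\mathbb{R}^+$ (not depending on $n$) and a $k$-query tester which, for every positive integer $n$, given oracle access to $f:\{0,1\}^n\to\{0,1\}$, accepts with probability $1$ if $f$ is $\mathcal{M}$-free, and, for every $\epsilon>0$, rejects with probability at least $\tau(\epsilon)$ if $f$ is $\epsilon$-far from the family of $\mathcal{M}$-free functions.
   Context: $\{0,1\}$ is identified with the field $\mathbb{F}_2$, and $\{0,1\}^n$ with $\mathbb{F}_2^n$; linear means $\mathbb{F}_2$-linear. A binary matroid represented by $v_1,\ldots,v_k\in\{0,1\}^k$ has complexity $c$ at coordinate $i$ if $\{v_j\}_{j\in[k]\setminus\{i\}}$ can be partitioned into $c+1$ (possibly empty) classes such that $v_i$ is not in the span of any of the classes. It has complexity $c$ if $c$ is the minimum such that it has complexity $c$ at coordinate $i$ for all $i\in[k]$. A function $f:\{0,1\}^n\to\{0,1\}$ is $\mathcal{M}$-free if for every linear map $L:\{0,1\}^k\to\{0,1\}^n$, $\langle f(L(v_1)),\ldots,f(L(v_k))\rangle\ne 1^k$. For $f,g:\{0,1\}^n\to\{0,1\}$, $\delta(f,g)=\Pr_x[f(x)\ne g(x)]$ with $x$ uniform in $\{0,1\}^n$; $f$ is $\epsilon$-far from a family $\mathcal{F}$ if $\delta(f,g)\ge\epsilon$ for every $g\in\mathcal{F}$. A $k$-query tester is a randomized procedure that queries $f$ at (at most) $k$ points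 and then accepts or rejects. *)

(* Defs.v *)
From mathcomp Require Import all_boot all_order all_algebra.
From mathcomp Require Import reals.

Set Implicit Arguments.
Unset Strict Implicit.
Unset Printing Implicit Defensive.

Import Order.TTheory GRing.Theory Num.Theory.
Local Open Scope ring_scope.

Notation cube n := ('rV['F_2]_n).

(* The linear structure of the codomain {0,1} is never used, so it is bool. *)
Notation boolfun n := {ffun cube n -> bool}.

Section Matroid.

Variables (k : nat) (v : 'I_k -> cube k).

(* The partition is indexed because its classes may be empty. *)
Definition complexity_at (i : 'I_k) (c : nat) : Prop :=
  exists P : 'I_c.+1 -> {set 'I_k},
    [/\ \bigcup_(a < c.+1) P a = [set~ i],
        forall a b : 'I_c.+1, a != b -> [disjoint P a & P b]
      & forall a : 'I_c.+1, v i \notin <<[seq v j | j in P a]>>%VS].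

Definition has_complexity (c : nat) : Prop :=
  (forall i : 'I_k, complexity_at i c) /\
  (forall c' : nat, (forall i : 'I_k, complexity_at i c') -> (c <= c')%N).

Definition matroid_free (n : nat) (f : boolfun n) : Prop :=
  forall L : {linear cube k -> cube n},
    [tuple f (L (v i)) | i < k] <> [tuple of nseq k true].

End Matroid.

Arguments matroid_free {k} v {n} f.

Definition delta (R : realType) (n : nat) (f g : boolfun n) : R :=
  #|[set x | f x != g x]|%:R / #|{: cube n}|%:R.

Definition far (R : realType) (n : nat) (eps : R) (f : boolfun n)
    (F : boolfun n -> Prop) : Prop :=
  forall g : boolfun n, F g -> eps <= delta R f g.

(* Deterministic adaptive query algorithms; in [Query x t0 t1] the run goes on
   with [t1] if the oracle's answer at [x] is 1 and with [t0] otherwise. *)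
Inductive query_tree (T : Type) : Type :=
| Answer of bool
| Query of T & query_tree T & query_tree T.

Fixpoint accepts (T : Type) (f : T -> bool) (t : query_tree T) : bool :=
  match t with
  | Answer b => b
  | Query x t0 t1 => if f x then accepts f t1 else accepts f t0
  end.

Fixpoint query_depth (T : Type) (t : query_tree T) : nat :=
  match t with
  | Answer _ => 0
  | Query _ t0 t1 => (maxn (query_depth t0) (query_depth t1)).+1
  end.

(* Finitely many seeds suffice: for given [k] and [n] there are only finitely
   many query trees of depth at most [k]. *)
Record tester (R : realType) (k n : nat) := Tester {
  seed : finType;
  weight : seed -> R;
  weight_ge0 : forall w, 0 <= weight w;
  weight_sum1 : \sum_w weight w = 1;
  strategy : seed -> query_tree (cube n);
  strategy_depth : forall w, (query_depth (strategy w) <= k)%N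
}.

Definition accept_prob (R : realType) (k n : nat) (T : tester R k n)
    (f : boolfun n) : R :=
  \sum_(w : seed T | accepts f (strategy w)) weight w.

Definition reject_prob (R : realType) (k n : nat) (T : tester R k n)
    (f : boolfun n) : R :=
  \sum_(w : seed T | ~~ accepts f (strategy w)) weight w.

(* Main.v *)
Require Import Defs.
From mathcomp Require Import all_boot all_order all_algebra.
From mathcomp Require Import reals.
From mathcomp Require Import ring lra.

Set Implicit Arguments.
Unset Strict Implicit.
Unset Printing Implicit Defensive.

(** The tester draws a linear map [L : F_2^k -> F_2^n] uniformly, queries [f] at
    the points [L (v i)] and rejects if all answers are 1.  A free [f] is never
    rejected, so everything rests on a removal lemma ([matroid_removal]): if [f]
    is far from free, a proportion of all maps [L] that does not depend on [n]
    exhibits the pattern.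

    The removal lemma follows Green's arithmetic regularity method.  By an
    energy increment ([regularity]) there is a subspace [H] of bounded
    codimension such that for all but few points [x] the coset [x + H] is
    unbiased: no character correlates with [f] minus its mean on the coset.
    Deleting from [f] the biased cosets and those on which [f] is sparse changes
    few values ([delta_clean]), so the pattern survives at some [L].  Now let
    [L'] run over the maps that agree with [L] modulo [H].  If the events
    [f (L' (v i)) = 1] were independent, their joint frequency would be the
    product of the densities of [f] on the dense cosets [L (v i) + H], which is
    bounded below; and [H] having bounded codimension, such [L'] form a
    proportion of all maps that is bounded below as well.

    Complexity 1 is what makes independence approximately true ([von_neumann]).
    If [v i] lies outside the span of each of two classes covering the other
    vectors, there are functionals [phi], [psi] equal to 1 at [v i], one
    vanishing on each class.  Perturbing [L'] by [phi] times [s] and [psi] times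
    [t], for [s] and [t] in [H], turns the [i]-th factor into a function of
    [s + t] and splits the others into a function of [s] and a function of [t].
    The Fourier transform diagonalises such a bilinear form
    ([bilinear_fourier]), so it is small when the [i]-th factor is replaced by
    its deviation from the mean on an unbiased coset ([unbiased_bilinear]). *)

Import Order.TTheory GRing.Theory Num.Theory.
Local Open Scope ring_scope.

(** * Cosets of a subspace and averages over them *)

(** Subspaces of F_2^n are presented as kernels of matrices [M], so the number
    of columns of [M] bounds the codimension.  The number of rows [r] is kept
    free because [kernel k M] is the group of maps F_2^k -> F_2^n with values
    in the subspace, over which the counting lemma averages. *)
Definition kernel (r n m : nat) (M : 'M['F_2]_(n, m)) : {set 'M['F_2]_(r, n)} :=
  [set h | h *m M == 0].

Definition coset (n m : nat) (M : 'M['F_2]_(n, m)) (a : cube n) :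
    {set cube n} :=
  [set x | x *m M == a *m M].

Definition avg (R : realFieldType) (n m : nat) (M : 'M['F_2]_(n, m))
    (f : cube n -> R) (a : cube n) : R :=
  (\sum_(x in coset M a) f x) / #|kernel 1 M|%:R.

Lemma card_cube (n : nat) : #|{: cube n}| = (2 ^ n)%N.
Proof. by rewrite card_mx card_Fp // mul1n. Qed.

Lemma kernel_gt0 (r n m : nat) (M : 'M['F_2]_(n, m)) : (0 < #|kernel r M|)%N.
Proof. by apply/card_gt0P; exists 0; rewrite inE mul0mx. Qed.

Lemma card_fiber_le (r n m : nat) (M : 'M['F_2]_(n, m)) (p : 'M['F_2]_(r, m)) :
  (#|[set x : 'M_(r, n) | x *m M == p]| <= #|kernel r M|)%N.
Proof.
case: (set_0Vmem [set x : 'M_(r, n) | x *m M == p]) => [->|[y]].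
  by rewrite cards0.
rewrite inE => /eqP yM.
rewrite -(card_imset _ (addIr (- y))); apply/subset_leq_card/subsetP => z.
case/imsetP=> x; rewrite !inE => /eqP xM ->.
by rewrite mulmxBl xM yM subrr.
Qed.

(** The fibres of [x |-> x *m M] are translates of the kernel or empty, and
    there are at most [2 ^ (r * m)] of them.  This is where the codimension
    bound becomes a density bound that does not depend on [n]. *)
Lemma card_le_kernel (r n m : nat) (M : 'M['F_2]_(n, m)) :
  (#|{: 'M['F_2]_(r, n)}| <= 2 ^ (r * m) * #|kernel r M|)%N.
Proof.
have -> : (2 ^ (r * m) = #|{: 'M['F_2]_(r, m)}|)%N by rewrite card_mx card_Fp.
rewrite -sum_nat_const -[leqLHS]sum1_card.
rewrite (partition_big (fun x : 'M['F_2]_(r, n) => x *m M) predT) //=.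
rewrite [leqRHS](eq_bigl predT) //; apply: leq_sum => p _; rewrite sum1_card.
by rewrite (leq_trans _ (card_fiber_le M p)) // cardsE.
Qed.

Lemma coset_shift (n m : nat) (M : 'M['F_2]_(n, m)) (a h : cube n) :
  (a + h \in coset M a) = (h \in kernel 1 M).
Proof. by rewrite !inE mulmxDl -subr_eq0 addrAC subrr add0r. Qed.

Lemma card_coset (n m : nat) (M : 'M['F_2]_(n, m)) (a : cube n) :
  #|coset M a| = #|kernel 1 M|.
Proof.
rewrite -!sum1_card [LHS](reindex_inj (addrI a)) /=.
by apply: eq_bigl => h; rewrite coset_shift.
Qed.

Lemma eq_coset (n m : nat) (M : 'M['F_2]_(n, m)) (x y : cube n) :
  x *m M = y *m M -> coset M x = coset M y.
Proof. by move=> xy; apply/setP=> z; rewrite !inE xy. Qed.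

Lemma eq_avg (R : realFieldType) (n m : nat) (M : 'M['F_2]_(n, m))
    (f : cube n -> R) (x y : cube n) :
  x *m M = y *m M -> avg M f x = avg M f y.
Proof. by move=> xy; rewrite /avg (eq_coset xy). Qed.

(** Averaging over cosets is the orthogonal projection onto the functions that
    are constant on cosets; being self-adjoint, it can be dropped when paired
    with such a function. *)
Lemma sum_avgM (R : realFieldType) (n m : nat) (M : 'M['F_2]_(n, m))
    (f g : cube n -> R) :
  (forall x y, x *m M = y *m M -> g x = g y) ->
  \sum_x avg M f x * g x = \sum_x f x * g x.
Proof.
move=> gM; set K : R := #|kernel 1 M|%:R.
have K0 : K != 0 by rewrite pnatr_eq0 -lt0n kernel_gt0.
transitivity (\sum_x \sum_(y in coset M x) f y * g y / K).
  apply: eq_bigr => x _; rewrite /avg mulrAC mulr_suml mulr_suml.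
  apply: eq_bigr => y; rewrite inE => /eqP /gM ->; first by [].
rewrite (exchange_big_dep predT) //=; apply: eq_bigr => y _.
rewrite (eq_bigl (mem (coset M y))); last by move=> x; rewrite !inE eq_sym.
by rewrite sumr_const card_coset -(mulr_natr (_ / K)) mulfVK.
Qed.

Lemma avg_bounds (R : realFieldType) (n m : nat) (M : 'M['F_2]_(n, m))
    (f : cube n -> R) (a : cube n) :
  (forall x, 0 <= f x <= 1) -> 0 <= avg M f a <= 1.
Proof.
move=> f01; have K0 : 0 < #|kernel 1 M|%:R :> R by rewrite ltr0n kernel_gt0.
rewrite divr_ge0 ?ler0n //; last first.
  by apply: sumr_ge0 => x _; case/andP: (f01 x).
rewrite ler_pdivrMr // mul1r -(card_coset M a) -sumr_const.
by apply: ler_sum => x _; case/andP: (f01 x).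
Qed.

(** * Fourier analysis on the cube *)

Definition chi (R : realFieldType) (n : nat) (g : 'cV['F_2]_n) (x : cube n) :
    R :=
  (-1) ^+ ((x *m g) 0 0 : nat).

Lemma signF2B (R : realFieldType) (a b : 'F_2) :
  (-1 : R) ^+ ((a - b)%R : nat) = (-1) ^+ (a : nat) * (-1) ^+ (b : nat).
Proof.
case: a b => [[|[|//]] ?] [[|[|//]] ?] /=;
 rewrite ?expr0 ?expr1 ?mulr1 ?mul1r ?mulrNN ?mulr1 //.
Qed.

Lemma chiB (R : realFieldType) (n : nat) (g : 'cV['F_2]_n) (x y : cube n) :
  chi R g (x - y) = chi R g x * chi R g y.
Proof. by rewrite /chi mulmxBl !mxE signF2B. Qed.

Lemma chi_sq (R : realFieldType) (n : nat) (g : 'cV['F_2]_n) (x : cube n) :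
  chi R g x ^+ 2 = 1.
Proof. by rewrite /chi sqrr_sign. Qed.

Lemma norm_chi (R : realFieldType) (n : nat) (g : 'cV['F_2]_n) (x : cube n) :
  `|chi R g x| = 1.
Proof. by rewrite /chi normr_sign. Qed.

Definition fourier (R : realFieldType) (n : nat) (F : cube n -> R)
    (g : 'cV['F_2]_n) : R := \sum_x F x * chi R g x.

Lemma cube_addvv n (x : cube n) : x + x = 0.
Proof.
apply/matrixP=> i j; rewrite !mxE.
by case: (x i j) => [[|[|//]] ?]; apply/val_inj.
Qed.

Lemma cube_oppv n (x : cube n) : - x = x.
Proof. by rewrite -[RHS]addr0 -(cube_addvv (-x)) addrA subrr add0r. Qed.

Lemma chiD (R : realFieldType) (n : nat) (g : 'cV['F_2]_n) (x y : cube n) :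
  chi R g (x + y) = chi R g x * chi R g y.
Proof. by rewrite -chiB cube_oppv. Qed.

(** Characters multiply in the index too; subtraction is used so that
    [signF2B] serves for both variables. *)
Lemma chiB_char (R : realFieldType) (n : nat) (g g' : 'cV['F_2]_n)
    (x : cube n) :
  chi R (g - g') x = chi R g x * chi R g' x.
Proof. by rewrite /chi mulmxBr !mxE signF2B. Qed.

(** If [x] has a nonzero [j]-th coordinate, subtracting the [j]-th coordinate
    functional from the index flips the sign of every term, so the sum equals
    its own opposite. *)
Lemma sum_chi (R : realFieldType) (n : nat) (x : cube n) :
  \sum_(g : 'cV['F_2]_n) chi R g x = (x == 0)%:R * (2 ^ n)%:R.
Proof.
have [->|/rV0Pn[j xj]] := eqVneq x 0.
  rewrite mul1r (eq_bigr (fun=> 1)) => [|g _]; last first.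
    by rewrite /chi mul0mx mxE expr0.
  by rewrite sumr_const card_mx card_Fp // muln1.
rewrite mul0r; set S := LHS.
suff : S = - S by lra.
pose d : 'cV['F_2]_n := delta_mx j 0.
have chid : chi R d x = -1.
  rewrite /chi -colE mxE; case: (x 0 j) xj => [[|[|//]] ?] //.
rewrite {1}/S (reindex_inj (addIr (- d))) -sumrN; apply: eq_bigr => g _.
by rewrite chiB_char chid mulrN1.
Qed.

(** The transform is an unnormalised sum, hence the factor [2 ^ n]. *)
Lemma fourier_inversion (R : realFieldType) (n : nat) (F : cube n -> R) x :
  \sum_(g : 'cV['F_2]_n) fourier F g * chi R g x = F x * (2 ^ n)%:R.
Proof.
rewrite (eq_bigr (fun g => \sum_y F y * chi R g (y - x))) => [|g _]; last first.
  by rewrite mulr_suml; apply: eq_bigr => y _; rewrite chiB mulrA.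
rewrite exchange_big /= (bigD1 x) //= -mulr_sumr sum_chi subrr eqxx mul1r.
rewrite big1 ?addr0 // => y yx.
by rewrite -mulr_sumr sum_chi subr_eq0 (negPf yx) mul0r mulr0.
Qed.

Lemma parseval (R : realFieldType) (n : nat) (F : cube n -> R) :
  \sum_(g : 'cV['F_2]_n) fourier F g ^+ 2 = (\sum_x F x ^+ 2) * (2 ^ n)%:R.
Proof.
rewrite (eq_bigr (fun g => \sum_x F x * (fourier F g * chi R g x))) => [|g _].
  rewrite exchange_big mulr_suml; apply: eq_bigr => x _ /=.
  by rewrite -mulr_sumr fourier_inversion mulrA.
by rewrite expr2 {2}/fourier mulr_sumr; apply: eq_bigr => x _; rewrite mulrCA.
Qed.

(** The Fourier transform diagonalises this form: up to the factor [2 ^ n] it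
    is the sum over characters of a product of three coefficients.  Taking out
    the largest coefficient of [F], the rest is controlled by Parseval after
    the inequality between arithmetic and geometric means, which loses nothing
    when [B1] and [B2] have the same norm. *)
Lemma bilinear_fourier (R : realFieldType) (n : nat) (F B1 B2 : cube n -> R)
    (a : cube n) (d : R) :
  (forall g, `|fourier F g| <= d) ->
  `|\sum_s \sum_t F (a + s + t) * (B1 s * B2 t)|
    <= d / 2 * (\sum_s B1 s ^+ 2 + \sum_t B2 t ^+ 2).
Proof.
move=> Fd; have N0 : 0 < (2 ^ n)%:R :> R by rewrite ltr0n expn_gt0.
have E : (\sum_s \sum_t F (a + s + t) * (B1 s * B2 t)) * (2 ^ n)%:R =
    \sum_(g : 'cV['F_2]_n)
      fourier F g * chi R g a * (fourier B1 g * fourier B2 g).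
  transitivity (\sum_(g : 'cV['F_2]_n) \sum_s \sum_t fourier F g * chi R g a *
      ((B1 s * chi R g s) * (B2 t * chi R g t))); last first.
    apply: eq_bigr => g _; rewrite [X in _ = _ * (X * _)]/fourier.
    rewrite mulr_suml mulr_sumr.
    by apply: eq_bigr => s _; rewrite !mulr_sumr.
  rewrite mulr_suml exchange_big; apply: eq_bigr => s _ /=.
  rewrite mulr_suml exchange_big; apply: eq_bigr => t _ /=.
  rewrite mulrAC -fourier_inversion mulr_suml; apply: eq_bigr => g _.
  by rewrite !chiD; ring.
rewrite -(ler_pM2r N0) -{1}(gtr0_norm N0) -normrM E.
rewrite -[leRHS]mulrA mulrDl -!parseval -big_split mulr_sumr /=.
apply: le_trans (ler_norm_sum _ _ _) _; apply: ler_sum => g _.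
rewrite !normrM norm_chi mulr1 -mulrA.
apply: ler_pM => //; first by rewrite mulr_ge0.
rewrite -[fourier B1 g ^+ 2]real_normK ?num_real //.
rewrite -[fourier B2 g ^+ 2]real_normK ?num_real //.
have := sqr_ge0 (`|fourier B1 g| - `|fourier B2 g|); lra.
Qed.

(** * Biased cosets *)

Definition correlation (R : realFieldType) (n m : nat) (M : 'M['F_2]_(n, m))
    (f : cube n -> R) (a : cube n) (g : 'cV['F_2]_n) : R :=
  \sum_(x in coset M a) (f x - avg M f x) * chi R g x.

(** The points whose coset sees a character correlate, beyond the proportion
    [eta], with the deviation of [f] from its mean on the coset. *)
Definition biased (R : realFieldType) (n m : nat) (M : 'M['F_2]_(n, m))
    (eta : R) (f : cube n -> R) : {set cube n} :=
  [set a | [exists g, eta * #|kernel 1 M|%:R < `|correlation M f a g|]].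

Lemma eq_biased (R : realFieldType) (n m : nat) (M : 'M['F_2]_(n, m))
    (eta : R) (f : cube n -> R) (x y : cube n) :
  x *m M = y *m M -> (x \in biased M eta f) = (y \in biased M eta f).
Proof. by move=> xy; rewrite !inE /correlation (eq_coset xy). Qed.

(** On an unbiased coset the centred function looks like noise to every
    rank-one test [b1 s * b2 t], which is the only form in which the counting
    lemma uses unbiasedness.  Everything is extended by zero to the whole cube,
    so that the Fourier analysis of the subspace is that of the cube. *)
Lemma unbiased_bilinear (R : realFieldType) (n m : nat) (M : 'M['F_2]_(n, m))
    (eta : R) (f : cube n -> R) (a : cube n) (b1 b2 : cube n -> R) :
  a \notin biased M eta f ->
  (forall s, `|b1 s| <= 1) -> (forall t, `|b2 t| <= 1) ->
  `|\sum_(s in kernel 1 M) \sum_(t in kernel 1 M)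
     (f (a + s + t) - avg M f a) * (b1 s * b2 t)|
  <= eta * #|kernel 1 M|%:R ^+ 2.
Proof.
rewrite inE negb_exists => /forallP unb b1_le b2_le.
set K := kernel 1 M; set K' : R := #|K|%:R.
pose F x := if x \in coset M a then f x - avg M f x else 0.
pose B (b : cube n -> R) s := if s \in K then b s else 0.
have BK b : (forall s, `|b s| <= 1) -> \sum_s B b s ^+ 2 <= K'.
  move=> b_le; rewrite /K' -sumr_const [leRHS]big_mkcond; apply: ler_sum => s _.
  rewrite /B; case: ifP => // _; last by rewrite expr0n.
  by rewrite -real_normK ?num_real // expr_le1.
have Fd g : `|fourier F g| <= eta * K'.
  have -> : fourier F g = correlation M f a g.
    rewrite /correlation [RHS]big_mkcond; apply: eq_bigr => x _.
    by rewrite /F; case: ifP => // _; rewrite mul0r.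
  by rewrite leNgt; apply: unb.
have -> : \sum_(s in K) \sum_(t in K)
      (f (a + s + t) - avg M f a) * (b1 s * b2 t) =
    \sum_s \sum_t F (a + s + t) * (B b1 s * B b2 t).
  rewrite [LHS]big_mkcond; apply: eq_bigr => s _; rewrite /B.
  case: ifP => [sK|_]; last by rewrite big1 // => t _; rewrite mul0r mulr0.
  rewrite [LHS]big_mkcond; apply: eq_bigr => t _.
  case: ifP => [tK|_]; last by rewrite !mulr0.
  have stM : (a + s + t) *m M = a *m M.
    move: sK tK; rewrite !inE => /eqP sM /eqP tM.
    by rewrite !mulmxDl sM tM !addr0.
  by rewrite /F inE stM eqxx (eq_avg _ stM).
apply: le_trans (bilinear_fourier _ _ _ Fd) _.
have d0 : 0 <= eta * K' by apply: le_trans (Fd 0).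
have := ler_wpM2l d0 (lerD (BK _ b1_le) (BK _ b2_le)); lra.
Qed.

(** * Energy increment and the regularity lemma *)

(** The squared norm of the projection of [f] onto the functions constant on
    cosets. *)
Definition energy (R : realFieldType) (n m : nat) (M : 'M['F_2]_(n, m))
    (f : cube n -> R) : R := \sum_x avg M f x ^+ 2.

(** Inclusion of kernels.  With a single column for [M], it says that a
    character is constant on the cosets of the kernel of [M']. *)
Definition refines (n m m' : nat) (M' : 'M['F_2]_(n, m'))
    (M : 'M['F_2]_(n, m)) : Prop :=
  forall x y : cube n, x *m M' = y *m M' -> x *m M = y *m M.

(** Pythagoras for the two nested projections. *)
Lemma energy_refine (R : realFieldType) (n m m' : nat) (M' : 'M['F_2]_(n, m'))
    (M : 'M['F_2]_(n, m)) (f : cube n -> R) :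
  refines M' M ->
  \sum_x (avg M' f x - avg M f x) ^+ 2 = energy M' f - energy M f.
Proof.
move=> ref.
have E : \sum_x avg M' f x * avg M f x = energy M f.
  rewrite (sum_avgM _ (g := avg M f)) => [|x y /ref /eq_avg -> //].
  rewrite -(sum_avgM (M := M) _ (g := avg M f)) => [|x y /eq_avg -> //].
  by apply: eq_bigr => x _; rewrite expr2.
transitivity (energy M' f - 2 * \sum_x avg M' f x * avg M f x + energy M f).
  rewrite /energy mulr_sumr -sumrB -big_split /=.
  by apply: eq_bigr => x _; ring.
by rewrite E; ring.
Qed.

(** The character and the coset are both visible to [M'], so [f] may be
    replaced by its finer average in the correlation; Cauchy-Schwarz then bounds
    it by the change of the average on the coset. *)
Lemma correlation_sq_le (R : realFieldType) (n m m' : nat)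
    (M' : 'M['F_2]_(n, m')) (M : 'M['F_2]_(n, m)) (f : cube n -> R) (a : cube n)
    (g : 'cV['F_2]_n) :
  refines M' M -> refines M' g ->
  correlation M f a g ^+ 2 <=
    #|kernel 1 M|%:R * \sum_(x in coset M a) (avg M' f x - avg M f x) ^+ 2.
Proof.
move=> refM refg; set K : R := #|_|%:R.
set D := fun x => avg M' f x - avg M f x.
have K0 : 0 < K by rewrite ltr0n kernel_gt0.
set W := correlation _ _ _ _.
have WD : W = \sum_(x in coset M a) D x * chi R g x.
  pose G x := if x \in coset M a then chi R g x else 0.
  have EG (h : cube n -> R) :
      \sum_(x in coset M a) h x * chi R g x = \sum_x h x * G x.
    rewrite big_mkcond; apply: eq_bigr => x _.
    by rewrite /G; case: ifP; rewrite ?mulr0.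
  have GM x y : x *m M' = y *m M' -> G x = G y.
    by move=> xy; rewrite /G !inE (refM _ _ xy) /chi (refg _ _ xy).
  rewrite /W /correlation !EG /D.
  under eq_bigr do rewrite mulrBl.
  under [RHS]eq_bigr do rewrite mulrBl.
  by rewrite !sumrB (sum_avgM _ GM).
(* Cauchy-Schwarz, as the positivity of the square at its optimal constant. *)
have : 0 <= \sum_(x in coset M a) (D x * chi R g x - W / K) ^+ 2.
  by apply: sumr_ge0 => x _; apply: sqr_ge0.
have -> : \sum_(x in coset M a) (D x * chi R g x - W / K) ^+ 2 =
    \sum_(x in coset M a) D x ^+ 2 - W ^+ 2 / K.
  transitivity (\sum_(x in coset M a) D x ^+ 2 - 2 * (W / K) * W +
      \sum_(x in coset M a) (W / K) ^+ 2); last first.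
    rewrite sumr_const card_coset -mulr_natr -/K.
    by field; rewrite gt_eqF.
  rewrite [X in _ * (_ / _) * X]WD mulr_sumr -sumrB -big_split /=.
  apply: eq_bigr => x _; rewrite sqrrB [(D x * _) ^+ 2]exprMn chi_sq.
  by ring.
by rewrite subr_ge0 ler_pdivrMr // mulrC.
Qed.

(** By [correlation_sq_le] the coset of a biased point gains at least
    [eta ^+ 2] times its size.  Summing over the biased points counts the gain
    of each coset as often as the coset has points, so the size cancels. *)
Lemma energy_increment (R : realFieldType) (n m m' : nat)
    (M' : 'M['F_2]_(n, m')) (M : 'M['F_2]_(n, m)) (f : cube n -> R) (eta : R) :
  0 <= eta -> refines M' M ->
  (forall a, a \in biased M eta f -> exists2 g : 'cV['F_2]_n,
     refines M' g & eta * #|kernel 1 M|%:R < `|correlation M f a g|) ->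
  energy M f + eta ^+ 2 * #|biased M eta f|%:R <= energy M' f.
Proof.
move=> eta0 ref wit; rewrite -lerBrDl -energy_refine //.
set K : R := #|kernel 1 M|%:R.
have K0 : 0 < K by rewrite ltr0n kernel_gt0.
set D := fun x => (avg M' f x - avg M f x) ^+ 2.
have Dcoset a : a \in biased M eta f ->
    eta ^+ 2 * K <= \sum_(x in coset M a) D x.
  case/wit=> g refg /ltW large; rewrite -(ler_pM2l K0).
  apply: le_trans (correlation_sq_le _ _ ref refg).
  rewrite -[leRHS]real_normK ?num_real // mulrCA -expr2 -exprMn.
  by rewrite ler_sqr ?nnegrE // mulr_ge0 // ltW.
rewrite -(ler_pM2r K0) mulr_natr mulrnAl -sumr_const.
apply: le_trans (ler_sum _ Dcoset) _.
apply: le_trans (_ : \sum_a \sum_(x in coset M a) D x <= _).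
  rewrite [leLHS]big_mkcond; apply: ler_sum => a _; case: ifP => // _.
  by apply: sumr_ge0 => x _; apply: sqr_ge0.
rewrite (exchange_big_dep predT) //= mulr_suml; apply: ler_sum => x _.
rewrite (eq_bigl (mem (coset M x))); last by move=> y; rewrite !inE eq_sym.
by rewrite sumr_const card_coset mulr_natr.
Qed.

(** The cosets are indexed by the values [p] of [x *m M].  Where a coset is
    biased this picks a character showing it, and 0 elsewhere. *)
Definition bias_witness (R : realFieldType) (n m : nat) (M : 'M['F_2]_(n, m))
    (eta : R) (f : cube n -> R) (p : cube m) : 'cV['F_2]_n :=
  odflt 0 [pick g | [exists a, (a *m M == p) &&
    (eta * #|kernel 1 M|%:R < `|correlation M f a g|)]].

(** All witnesses are adjoined at once, one column for each potential coset:
    a single character is only sure to gain energy on its own coset, whose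
    density decays with the number of columns, whereas all of them together gain
    an amount that depends only on the proportion of biased points. *)
Definition adjoin_witnesses (R : realFieldType) (n m : nat)
    (M : 'M['F_2]_(n, m)) (eta : R) (f : cube n -> R) :
    'M['F_2]_(n, m + #|{: cube m}|) :=
  row_mx M (\matrix_(i, j) bias_witness M eta f (enum_val j) i 0).

Lemma adjoin_refines (R : realFieldType) (n m : nat) (M : 'M['F_2]_(n, m))
    (eta : R) (f : cube n -> R) : refines (adjoin_witnesses M eta f) M.
Proof. by move=> x y; rewrite !mul_mx_row => /eq_row_mx[]. Qed.

Lemma adjoin_refines_witness (R : realFieldType) (n m : nat)
    (M : 'M['F_2]_(n, m)) (eta : R) (f : cube n -> R) (p : cube m) :
  refines (adjoin_witnesses M eta f) (bias_witness M eta f p).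
Proof.
move=> x y; rewrite !mul_mx_row => /eq_row_mx[_ /(congr1 (col (enum_rank p)))].
rewrite !colE -!mulmxA -colE; set N := col _ _.
suff -> : N = bias_witness M eta f p by [].
by apply/matrixP=> i j; rewrite !mxE enum_rankK ord1.
Qed.

Lemma energy_adjoin (R : realFieldType) (n m : nat) (M : 'M['F_2]_(n, m))
    (eta : R) (f : cube n -> R) :
  0 <= eta ->
  energy M f + eta ^+ 2 * #|biased M eta f|%:R
    <= energy (adjoin_witnesses M eta f) f.
Proof.
move=> eta0; apply: energy_increment => //; first exact: adjoin_refines.
move=> a; rewrite inE => /existsP[g large].
exists (bias_witness M eta f (a *m M)); first exact: adjoin_refines_witness.
rewrite /bias_witness; case: pickP => [g' /existsP[b /andP[/eqP ba]]|none] /=.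
  by rewrite /correlation (eq_coset ba).
by have /existsP[] := none g; exists a; rewrite eqxx.
Qed.

(** The number of columns after [j] refinements.  The step is [d + 2 ^ d],
    written as the type of [adjoin_witnesses] has it to avoid casts. *)
Definition tower (j : nat) : nat := iter j (fun d => d + #|{: cube d}|)%N 0%N.

Lemma leq_tower (i j : nat) : (i <= j)%N -> (tower i <= tower j)%N.
Proof.
move=> /subnK <-; elim: (j - i)%N => // d IH.
exact: leq_trans IH (leq_addr _ _).
Qed.

Lemma regular_or_energetic (R : realFieldType) (n : nat) (f : cube n -> R)
    (eps eta : R) (J : nat) :
  0 <= eta ->
  (exists j (M : 'M['F_2]_(n, tower j)),
    (j <= J)%N /\ #|biased M eta f|%:R <= eps * (2 ^ n)%:R) \/
  exists M : 'M['F_2]_(n, tower J),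
    J%:R * (eta ^+ 2 * (eps * (2 ^ n)%:R)) <= energy M f.
Proof.
move=> eta0; elim: J => [|J [[j [M [jJ reg]]]|[M enM]]].
- right; exists 0; rewrite mul0r; apply: sumr_ge0 => x _; exact: sqr_ge0.
- by left; exists j, M; split => //; apply: leqW.
- have [reg|irreg] := lerP #|biased M eta f|%:R (eps * (2 ^ n)%:R).
    by left; exists J, M.
  right; exists (adjoin_witnesses M eta f).
  apply: le_trans (energy_adjoin _ _ eta0).
  rewrite -natr1 mulrDl mul1r lerD // ler_wpM2l ?exprn_ge0 //; exact: ltW.
Qed.

(** Energy is at most [2 ^ n] and grows by [eta ^+ 2 * eps * 2 ^ n] as long as
    more than the proportion [eps] of the points is biased, so the refinement
    stops after a number of steps that does not depend on [n]. *)
Theorem regularity (R : archiRealFieldType) (n : nat) (f : cube n -> R)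
    (eps eta : R) :
  0 < eps -> 0 < eta -> (forall x, 0 <= f x <= 1) ->
  exists j (M : 'M['F_2]_(n, tower j)),
    (j <= Num.bound (eta ^+ 2 * eps)^-1)%N /\
    #|biased M eta f|%:R <= eps * (2 ^ n)%:R.
Proof.
move=> eps0 eta0 f01; set J := Num.bound _.
have [//|[M]] := regular_or_energetic f eps J (ltW eta0).
have c0 : 0 < eta ^+ 2 * eps by rewrite mulr_gt0 ?exprn_gt0.
have N0 : 0 < (2 ^ n)%:R :> R by rewrite ltr0n expn_gt0.
have enN : energy M f <= (2 ^ n)%:R.
  rewrite -(card_cube n) -sumr_const; apply: ler_sum => x _.
  by case/andP: (avg_bounds M x f01) => a0 a1; rewrite expr_le1.
move=> /le_trans /(_ enN); rewrite (mulrA (eta ^+ 2)) mulrA leNgt => /negP[].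
rewrite -[ltLHS]mul1r ltr_pM2r // -ltr_pdivrMr // mul1r.
by rewrite archi_boundP // invr_ge0 ltW.
Qed.

(** * Counting in unbiased cosets *)

(** The defect of [w] under a projection onto [U] has a nonzero coordinate,
    and that coordinate of the defect, scaled, is the functional. *)
Lemma separating_functional (F : fieldType) (k : nat) (U : {vspace 'rV[F]_k})
    (w : 'rV[F]_k) :
  w \notin U ->
  exists2 phi : 'cV[F]_k, w *m phi = 1%:M & forall u, u \in U -> u *m phi = 0.
Proof.
move=> wU; set q := 1%:M - lin1_mx (projv U).
have qE u : u *m q = u - projv U u by rewrite mulmxBr mulmx1 mul_rV_lin1.
have /rV0Pn[j wj] : w *m q != 0.
  by rewrite qE subr_eq0; apply: contra wU => /eqP ->; apply: memv_proj.
exists (((w *m q) 0 j)^-1 *: col j q) => [|u uU].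
  rewrite -scalemxAr colE mulmxA -colE; apply/matrixP=> a b.
  by rewrite !ord1 mxE [col _ _ _ _]mxE mulVf // mxE.
by rewrite -scalemxAr colE mulmxA (qE u) projv_id // subrr mul0mx scaler0.
Qed.

Lemma kernel_outer (r n m : nat) (M : 'M['F_2]_(n, m)) (phi : 'cV['F_2]_r)
    (s : cube n) : s \in kernel 1 M -> phi *m s \in kernel r M.
Proof. by rewrite !inE -mulmxA => /eqP ->; rewrite mulmx0. Qed.

Lemma kernelD (r n m : nat) (M : 'M['F_2]_(n, m)) (h h' : 'M['F_2]_(r, n)) :
  h' \in kernel r M -> (h + h' \in kernel r M) = (h \in kernel r M).
Proof. by rewrite !inE mulmxDl => /eqP ->; rewrite addr0. Qed.

Lemma sum_kernel_shift (R : realFieldType) (r n m : nat) (M : 'M['F_2]_(n, m))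
    (F : 'M['F_2]_(r, n) -> R) (h' : 'M['F_2]_(r, n)) :
  h' \in kernel r M ->
  \sum_(h in kernel r M) F (h + h') = \sum_(h in kernel r M) F h.
Proof.
move=> h'K; rewrite [RHS](reindex_inj (addIr h')) /=.
by apply: eq_bigl => h; rewrite kernelD.
Qed.

(** Complexity 1 provides functionals [phi] and [psi] that are 1 at [v i] and
    vanish on the first, respectively the second, class.  The average over [h]
    does not change under the shift of [h] by [phi *m s + psi *m t].  After it,
    the factor of index [i] depends on [s + t], those of the first class only
    on [t], and those of the second class only on [s]: for each fixed [h] what
    remains is a rank-one test of a centred function on an unbiased coset. *)
Lemma von_neumann (R : realFieldType) (k n m : nat) (v : 'I_k -> cube k)
    (i : 'I_k) (M : 'M['F_2]_(n, m)) (A : 'M['F_2]_(k, n)) (f : cube n -> R)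
    (u : 'I_k -> cube n -> R) (eta : R) :
  complexity_at v i 1 -> (forall j x, `|u j x| <= 1) ->
  v i *m A \notin biased M eta f ->
  `|\sum_(h in kernel k M) (f (v i *m (A + h)) - avg M f (v i *m A)) *
      \prod_(j | j != i) u j (v j *m (A + h))| <= eta * #|kernel k M|%:R.
Proof.
case=> P [Pi Pdisj Pspan] u1 unb.
have [phi vphi phi0] := separating_functional (Pspan ord0).
have [psi vpsi psi0] := separating_functional (Pspan ord_max).
have killed a j (th : 'cV_k) : j \in P a ->
    (forall x, x \in <<[seq v j | j in P a]>>%VS -> x *m th = 0) ->
    v j *m th = 0.
  by move=> jP; apply; apply/memv_span/map_f; rewrite mem_enum.
set alpha := avg M f _.
set Phi := fun h => (f (v i *m (A + h)) - alpha) *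
  \prod_(j | j != i) u j (v j *m (A + h)).
set K := kernel 1 M; have K0 : 0 < #|K|%:R :> R by rewrite ltr0n kernel_gt0.
have -> : \sum_(h in kernel k M) (f (v i *m (A + h)) - alpha) *
  \prod_(j | j != i) u j (v j *m (A + h)) = \sum_(h in kernel k M) Phi h by [].
rewrite -(ler_pM2r (exprn_gt0 2 K0)).
rewrite -[X in _ * X <= _]ger0_norm ?exprn_ge0 ?ler0n //.
rewrite -normrM.
(* Averaging over all shifts by elements of the subspace. *)
have -> : (\sum_(h in kernel k M) Phi h) * #|K|%:R ^+ 2 =
    \sum_(h in kernel k M) \sum_(s in K) \sum_(t in K)
      Phi (h + phi *m s + psi *m t).
  rewrite [RHS]exchange_big /=.
  under [RHS]eq_bigr do rewrite exchange_big /=.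
  have E s t : s \in K -> t \in K ->
      \sum_(h in kernel k M) Phi (h + phi *m s + psi *m t) =
      \sum_(h in kernel k M) Phi h.
    move=> sK tK; under eq_bigr do rewrite -addrA.
    by rewrite sum_kernel_shift // kernelD ?kernel_outer.
  rewrite [RHS](eq_bigr (fun=> (\sum_(h in kernel k M) Phi h) *+ #|K|))
    => [|s sK].
    by rewrite sumr_const -mulrnA mulnn -natrX mulr_natr.
  by rewrite -sumr_const; apply: eq_bigr => t tK; apply: E.
rewrite -mulrA (mulrC _%:R) mulrA mulr_natr -sumr_const.
apply: le_trans (ler_norm_sum _ _ _) _; apply: ler_sum => h.
rewrite inE => /eqP hM.
pose c := v i *m (A + h).
have cM : c *m M = v i *m A *m M.
  by rewrite /c -mulmxA mulmxDl hM addr0 mulmxA.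
pose b2 t := \prod_(j in P ord0) u j (v j *m (A + h) + (v j *m psi) *m t).
pose b1 s := \prod_(j in P ord_max) u j (v j *m (A + h) + (v j *m phi) *m s).
have b_le (Q : {set 'I_k}) (w : 'I_k -> cube n):
    `|\prod_(j in Q) u j (w j)| <= 1.
  by rewrite normr_prod; apply: prodr_ile1 => j _; rewrite normr_ge0 u1.
have PhiE s t : Phi (h + phi *m s + psi *m t) =
    (f (c + s + t) - avg M f c) * (b1 s * b2 t).
  rewrite /Phi (eq_avg _ cM) -/alpha; congr ((f _ - _) * _).
    rewrite 2!addrA mulmxDr mulmxDr [v i *m (phi *m s)]mulmxA.
    by rewrite [v i *m (psi *m t)]mulmxA vphi vpsi !mul1mx.
  rewrite (eq_bigl (mem (\bigcup_(a < 2) P a))) => [|j]; last first.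
    by rewrite Pi !inE.
  rewrite partition_disjoint_bigcup // big_ord_recl big_ord1 mulrC.
  have -> : lift ord0 ord0 = ord_max :> 'I_2 by apply/val_inj.
  congr (_ * _); apply: eq_bigr => j jP; congr (u j _).
    rewrite 2!addrA mulmxDr mulmxDr !mulmxA (killed _ _ _ jP phi0).
    by rewrite mul0mx addr0.
  rewrite 2!addrA mulmxDr mulmxDr !mulmxA (killed _ _ _ jP psi0).
  by rewrite mul0mx addr0.
under eq_bigr do under eq_bigr do rewrite PhiE.
apply: unbiased_bilinear; first by rewrite (eq_biased _ _ cM).
  by move=> s; apply: b_le.
by move=> t; apply: b_le.
Qed.

(** The factors are replaced by their averages one at a time; by [von_neumann]
    each of the [k] replacements costs at most [eta]. *)
Lemma counting (R : realFieldType) (k n m : nat) (v : 'I_k -> cube k)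
    (M : 'M['F_2]_(n, m)) (A : 'M['F_2]_(k, n)) (f : cube n -> R) (e eta : R) :
  (forall i, complexity_at v i 1) -> (forall x, 0 <= f x <= 1) -> 0 <= e ->
  (forall i, v i *m A \notin biased M eta f) ->
  (forall i, e <= avg M f (v i *m A)) ->
  (e ^+ k - k%:R * eta) * #|kernel k M|%:R <=
    \sum_(h in kernel k M) \prod_i f (v i *m (A + h)).
Proof.
move=> cx f01 e0 unb dense.
pose alpha i := avg M f (v i *m A).
have alpha01 i : 0 <= alpha i <= 1 by apply: avg_bounds.
pose T j := \sum_(h in kernel k M)
  \prod_(i < k) (if (i < j)%N then f (v i *m (A + h)) else alpha i).
have T0 : e ^+ k * #|kernel k M|%:R <= T 0%N.
  rewrite mulr_natr -sumr_const; apply: ler_sum => h _.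
  rewrite -[in leLHS](card_ord k) -prodr_const; apply: ler_prod => i _.
  by rewrite e0 dense.
have Tstep j : (j < k)%N -> T j - eta * #|kernel k M|%:R <= T j.+1.
  move=> jk; pose i := Ordinal jk.
  pose u (l : 'I_k) x := if (l < j)%N then f x else alpha l.
  have u1 l x : `|u l x| <= 1.
    have [/andP[f0 f1] /andP[a0 a1]] := (f01 x, alpha01 l).
    by rewrite /u; case: ifP => _; rewrite ger0_norm.
  have := von_neumann (cx i) u1 (unb i).
  set S := (X in `|X|); suff -> : S = T j.+1 - T j.
    by rewrite ler_norml => /andP[]; lra.
  rewrite /T -sumrB; apply: eq_bigr => h _.
  rewrite [in RHS](bigD1 i) //= [X in _ = _ - X](bigD1 i) //= ltnn leqnn.
  rewrite mulrBl; congr (_ * _ - _ * _); apply: eq_bigr => l li.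
  by rewrite ltnS leq_eqVlt (negPf (li : l != j :> nat)).
have Tj j : (j <= k)%N -> (e ^+ k - j%:R * eta) * #|kernel k M|%:R <= T j.
  elim: j => [|j IH] jk; first by rewrite mul0r subr0.
  have := IH (ltnW jk); have := Tstep j jk; rewrite -natr1; lra.
apply: le_trans (Tj k (leqnn k)) _; apply: ler_sum => h _.
apply: ler_prod => i _; rewrite ltn_ord lexx andbT.
by case/andP: (f01 (v i *m (A + h))).
Qed.

(** * The tester *)

(** A linear map F_2^k -> F_2^n is represented by the matrix acting on row
    vectors from the right. *)
Definition witnesses (k n : nat) (v : 'I_k -> cube k) (f : boolfun n) :
    {set 'M['F_2]_(k, n)} :=
  [set A : 'M_(k, n) | [forall i, f (v i *m A)]].

Lemma matroid_freeE (k n : nat) (v : 'I_k -> cube k) (f : boolfun n) :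
  matroid_free v f <-> witnesses v f = set0.
Proof.
have ones (w : 'I_k -> bool) :
    [tuple w i | i < k] = [tuple of nseq k true] <-> forall i, w i.
  split=> [E i|w1]; first by rewrite -(tnth_mktuple w) E tnth_nseq.
  by apply: eq_from_tnth => i; rewrite tnth_mktuple tnth_nseq w1.
split=> [free|none L /ones hit].
  apply/setP=> A; rewrite !inE; apply/negP=> /forallP hit.
  by apply: (free (mulmxr A)); apply/ones.
have : lin1_mx L \in witnesses v f.
  by rewrite inE; apply/forallP=> i; rewrite mul_rV_lin1.
by rewrite none inE.
Qed.

Fixpoint query_all (T : Type) (s : seq T) : query_tree T :=
  if s is x :: s' then Query x (Answer T true) (query_all s')
  else Answer T false.

Lemma accepts_query_all (T : Type) (f : T -> bool) (s : seq T) :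
  accepts f (query_all s) = ~~ all f s.
Proof. by elim: s => //= x s ->; case: (f x). Qed.

Lemma query_all_depth (T : Type) (s : seq T) :
  query_depth (query_all s) = size s.
Proof. by elim: s => //= x s ->; rewrite max0n. Qed.

Definition random_map_weight (R : realType) (k n : nat)
    (A : 'M['F_2]_(k, n)) : R := #|{: 'M['F_2]_(k, n)}|%:R^-1.

(** The run rejects exactly if all the queried values are 1. *)
Definition probe (k n : nat) (v : 'I_k -> cube k) (A : 'M['F_2]_(k, n)) :
    query_tree (cube n) :=
  query_all [seq v i *m A | i <- enum 'I_k].

Lemma random_map_weight_ge0 (R : realType) (k n : nat) (A : 'M['F_2]_(k, n)) :
  0 <= random_map_weight R A.
Proof. by rewrite invr_ge0 ler0n. Qed.

Lemma random_map_weight_sum1 (R : realType) (k n : nat) :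
  \sum_(A : 'M['F_2]_(k, n)) random_map_weight R A = 1.
Proof.
rewrite sumr_const -[LHS]mulr_natr mulVf // pnatr_eq0 -lt0n.
by apply/card_gt0P; exists 0.
Qed.

Lemma probe_depth (k n : nat) (v : 'I_k -> cube k) (A : 'M['F_2]_(k, n)) :
  (query_depth (probe v A) <= k)%N.
Proof. by rewrite query_all_depth size_map size_enum_ord. Qed.

Definition random_map_tester (R : realType) (k : nat) (v : 'I_k -> cube k)
    (n : nat) : tester R k n :=
  Tester (@random_map_weight_ge0 R k n) (@random_map_weight_sum1 R k n)
    (@probe_depth k n v).

Lemma accepts_probe (k n : nat) (v : 'I_k -> cube k) (f : boolfun n)
    (A : 'M['F_2]_(k, n)) :
  accepts f (probe v A) = (A \notin witnesses v f).
Proof.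
rewrite accepts_query_all inE all_map; congr (~~ _).
by apply/allP/forallP => [h i|h i _]; [apply: h; rewrite mem_enum|apply: h].
Qed.

Lemma accept_random_map_tester (R : realType) (k n : nat) (v : 'I_k -> cube k)
    (f : boolfun n) :
  matroid_free v f -> accept_prob (random_map_tester R v n) f = 1.
Proof.
move/matroid_freeE => none; rewrite -(random_map_weight_sum1 R k n).
by apply: eq_bigl => A; rewrite accepts_probe none inE.
Qed.

Lemma reject_random_map_tester (R : realType) (k n : nat) (v : 'I_k -> cube k)
    (f : boolfun n) :
  reject_prob (random_map_tester R v n) f =
    #|witnesses v f|%:R / #|{: 'M['F_2]_(k, n)}|%:R.
Proof.
rewrite /reject_prob (eq_bigl (mem (witnesses v f))) => [|A]; last first.
  by rewrite accepts_probe negbK.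
by rewrite sumr_const -[LHS]mulr_natl.
Qed.

(** * The removal lemma *)

(** Chosen so that the total error [k * eta] of the counting lemma stays below
    half of the main term; [k.+1] keeps the denominator nonzero.  Cleaning [f]
    with the threshold [eps / 3] changes a proportion of at most [2 * (eps / 3)]
    of its values, strictly below [eps]. *)
Definition removal_eta (R : realType) (k : nat) (eps : R) : R :=
  (eps / 3) ^+ k / (2 * k.+1%:R).

Definition removal_dim (R : realType) (k : nat) (eps : R) : nat :=
  tower (Num.bound (removal_eta k eps ^+ 2 * (eps / 3))^-1).

Definition removal_tau (R : realType) (k : nat) (eps : R) : R :=
  (eps / 3) ^+ k / 2 / (2 ^ (k * removal_dim k eps))%:R.

Lemma removal_eta_gt0 (R : realType) (k : nat) (eps : R) :
  0 < eps -> 0 < removal_eta k eps.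
Proof. by move=> eps0; rewrite !(divr_gt0, mulr_gt0, exprn_gt0) ?ltr0n. Qed.

Lemma removal_tau_gt0 (R : realType) (k : nat) (eps : R) :
  0 < eps -> 0 < removal_tau k eps.
Proof.
by move=> eps0; rewrite !(divr_gt0, exprn_gt0) ?ltr0n ?expn_gt0.
Qed.

(** The subset of [f] left after deleting it on the biased cosets and on those
    where its density is below [e].  Any occurrence of the pattern in it lies in
    unbiased and dense cosets. *)
Definition clean (R : realFieldType) (n m : nat) (M : 'M['F_2]_(n, m))
    (e eta : R) (f : boolfun n) : boolfun n :=
  [ffun x => [&& f x, x \notin biased M eta (fun y => (f y)%:R)
                & e <= avg M (fun y => (f y)%:R) x]].

(** The sparse part is [f] paired with a function constant on cosets, so it has
    the same size as the average of [f] on the sparse cosets, which is below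
    [e] at each point. *)
Lemma delta_clean (R : realType) (n m : nat) (M : 'M['F_2]_(n, m))
    (e eta : R) (f : boolfun n) :
  #|biased M eta (fun y => (f y)%:R)|%:R <= e * (2 ^ n)%:R -> 0 <= e ->
  delta R f (clean M e eta f) <= 2 * e.
Proof.
move=> fewbiased e0; set F := fun y => (f y)%:R : R.
have N0 : 0 < (2 ^ n)%:R :> R by rewrite ltr0n expn_gt0.
rewrite /delta card_cube ler_pdivrMr //.
pose sparse := [set x | f x & avg M F x < e].
have sub : [set x | f x != clean M e eta f x] \subset biased M eta F :|: sparse.
  apply/subsetP=> x; rewrite in_setU [x \in sparse]inE inE ffunE -/F.
  case: (f x) => //=; case: (x \in biased _ _ _) => //=.
  by rewrite -ltNge; case: ltP.
apply: le_trans (_ : #|biased M eta F :|: sparse|%:R <= _).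
  by rewrite ler_nat subset_leq_card.
apply: le_trans (_ : #|biased M eta F|%:R + #|sparse|%:R <= _).
  by rewrite -natrD ler_nat cardsU leq_subr.
suff : #|sparse|%:R <= e * (2 ^ n)%:R by move: fewbiased; rewrite -/F; lra.
pose G x : R := (avg M F x < e)%R%:R.
have -> : #|sparse|%:R = \sum_x F x * G x.
  rewrite -sum1_card natr_sum big_mkcond; apply: eq_bigr => x _.
  by rewrite /F /G inE -natrM mulnb; case: (_ && _).
rewrite -(sum_avgM (M := M)) => [|x y xy]; last by rewrite /G (eq_avg _ xy).
rewrite -card_cube mulr_natr -sumr_const; apply: ler_sum => x _; rewrite /G.
by case: ltP => [/ltW|_]; rewrite ?mulr1 ?mulr0.
Qed.

(** As [f] is far, its cleaned version still contains the pattern at some [A],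
    and the counting lemma around [A] finds many occurrences in [f]. *)
Theorem matroid_removal (R : realType) (k n : nat) (v : 'I_k -> cube k)
    (f : boolfun n) (eps : R) :
  (forall i, complexity_at v i 1) -> 0 < eps ->
  far eps f (matroid_free v) ->
  removal_tau k eps * #|{: 'M['F_2]_(k, n)}|%:R <= #|witnesses v f|%:R.
Proof.
move=> cx eps0 farf; set e := eps / 3; set eta := removal_eta k eps.
have e0 : 0 < e by rewrite divr_gt0.
have eta0 : 0 < eta by apply: removal_eta_gt0.
pose F y : R := (f y)%:R.
have F01 x : 0 <= F x <= 1 by rewrite /F; case: (f x); rewrite ?lexx ?ler01.
have [j [M [jJ reg]]] := regularity e0 eta0 F01.
pose f' := clean M e eta f.
have [A] : exists A, A \in witnesses v f'.
  apply/set0Pn/eqP => /matroid_freeE /farf.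
  have := delta_clean reg (ltW e0); rewrite -/f' /e; lra.
rewrite inE => /forallP hit.
have unb i : v i *m A \notin biased M eta F.
  by have := hit i; rewrite ffunE => /and3P[].
have dense i : e <= avg M F (v i *m A).
  by have := hit i; rewrite ffunE => /and3P[].
apply: le_trans (_ : e ^+ k / 2 * #|kernel k M|%:R <= _).
  rewrite /removal_tau -mulrA ler_wpM2l ?divr_ge0 ?exprn_ge0 ?(ltW e0) //.
  rewrite ler_pdivrMl ?ltr0n ?expn_gt0 // -natrM ler_nat.
  apply: leq_trans (card_le_kernel k M) _; rewrite leq_mul2r; apply/orP; right.
  by rewrite leq_exp2l // leq_mul2l leq_tower ?orbT.
have half : e ^+ k / 2 <= e ^+ k - k%:R * eta.
  have k0 : 0 < k.+1%:R :> R by rewrite ltr0n.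
  have etaE : e ^+ k / 2 = k.+1%:R * eta.
    by rewrite /eta /removal_eta; field; rewrite nat1r gt_eqF.
  by move: etaE; rewrite -[k.+1%:R]natr1; lra.
apply: le_trans (ler_wpM2r (ler0n _ _) half) _.
apply: le_trans (counting cx F01 (ltW e0) unb dense) _.
have -> : \sum_(h in kernel k M) \prod_i F (v i *m (A + h)) =
    #|[set h in kernel k M | A + h \in witnesses v f]|%:R.
  rewrite -sum1_card natr_sum big_mkcond [RHS]big_mkcond.
  apply: eq_bigr => h _; rewrite inE; case: (h \in kernel k M) => //=.
  rewrite inE /F; case: forallP => [all1|notall].
    by rewrite big1 // => i _; rewrite all1.
  have [i hi] : exists i, ~~ f (v i *m (A + h)).
    by apply/existsP; rewrite -negb_forall; apply/forallP.
  by rewrite (bigD1 i) //= (negPf hi) mul0r.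
rewrite ler_nat -(card_imset _ (addrI A)); apply/subset_leq_card/subsetP.
by move=> B /imsetP[h]; rewrite inE => /andP[_ hw] ->.
Qed.

Theorem lemma2p5 (R : realType) (k : nat) (v : 'I_k -> cube k) :
  has_complexity v 1 ->
  exists (tau : R -> R) (T : forall n : nat, tester R k n),
    (forall eps : R, 0 < eps -> 0 < tau eps) /\
    (forall n : nat, (0 < n)%N -> forall f : boolfun n,
       (matroid_free v f -> accept_prob (T n) f = 1) /\
       (forall eps : R, 0 < eps -> far eps f (matroid_free v) ->
          tau eps <= reject_prob (T n) f)).
Proof.
case=> cx _; exists (@removal_tau R k), (@random_map_tester R k v).
split=> [eps|n _ f]; first exact: removal_tau_gt0.
split=> [|eps eps0 farf]; first exact: accept_random_map_tester.
rewrite reject_random_map_tester ler_pdivlMr; first exact: matroid_removal.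
by rewrite ltr0n; apply/card_gt0P; exists 0.
Qed.
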